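(* (i) Every extension of a fragment of a local or of a global modal logic in which some connective among $\{\land,\lor,\to\}$ is term-definable has an algebraic semantics. (ii) Every extension of a fragment of a substructural logic with exchange in which some connective among $\{\land,\lor,\cdot,\to\}$ is term-definable has an algebraic semantics.
   Context: A logic is a substitution-invariant consequence relation on the formulas of an algebraic language; an extension of $\vdash$ is a logic in the same language containing $\vdash$; for a sublanguage $\mathscr{L}$, the $\mathscr{L}$-fragment of $\vdash$ is the restriction of $\vdash$ to $\mathscr{L}$-formulas. A modal algebra is a Boolean algebra $\langle A;\land,\lor,\lnot,0,1\rangle$ with a unary operation $\Box$ satisfying $\Box1=1$ and $\Box(a\land c)=\Box a\land\Box c$ (with $a\to c:=\lnot a\lor c$). For a variety $\mathsf K$ of modal algebras, the global modal logic $\vdash_{\mathsf K}$ is given by $\Gamma\vdash_{\mathsf K}\varphi$ iff $\{\gamma\approx1:\gamma\in\Gamma\}\vDash_{\mathsf K}\varphi\approx1$, and the local modal logic $\vdash^{\ell}_{\mathsf K}$ by $\Gamma\vdash^\ell_{\mathsf K}\varphi$ iff for all $\boldsymbol A\in\mathsf K$, $a\in A$ and homomorphisms $h$ from the formula algebra to $\boldsymbol A$, if $a\le h(\gamma)$ for all $\gamma\in\Gamma$ then $a\le h(\varphi)$. A commutative FL-algebra is $\langle A;\land,\lor,\cdot,\to,1,0\rangle$ with $\langle A;\land,\lor\rangle$ a lattice, $\langle A;\cdot,1\rangle$ a commutative monoid, $0$ a constant, and $a\cdot b\le c \iff a\le b\to c$. For a variety $\mathsf K$ of commutative FL-algebras,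 the substructural logic with exchange $\vdash_{\mathsf K}$ is given by $\Gamma\vdash_{\mathsf K}\varphi$ iff $\{\gamma\land1\approx1:\gamma\in\Gamma\}\vDash_{\mathsf K}\varphi\land1\approx1$. A connective $\ast$ is term-definable in a fragment if there is a formula $x+y$ of the fragment's language whose term function coincides with the operation $\ast$ on the algebras of $\mathsf K$. Here $\vDash_{\mathsf K}$ is equational consequence relative to $\mathsf K$. A logic $\vdash$ has an algebraic semantics if there are a set of equations $\boldsymbol{\tau}(x)$ in one variable and a class $\mathsf C$ of algebras of its language such that $\Gamma\vdash\varphi$ iff $\boldsymbol{\tau}[\Gamma]\vDash_{\mathsf C}\boldsymbol{\tau}(\varphi)$, where $\boldsymbol{\tau}[\Gamma]$ is the set of instances of $\boldsymbol\tau$ with $x$ replaced by members of $\Gamma$. *)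

(* Defs.v *)
From mathcomp Require Import all_boot.
From mathcomp Require Import boolp classical_sets.

Set Implicit Arguments.
Unset Strict Implicit.
Unset Printing Implicit Defensive.

Local Open Scope classical_set_scope.

(** * Languages, formulas, algebras *)

Record language := Language { symbol : Type; arity : symbol -> nat }.

Inductive term (S : language) (X : Type) : Type :=
| Var of X
| App (f : symbol S) of ('I_(arity f) -> term S X).

Arguments Var {S X} x.
Arguments App {S X} f ts.

Definition formula (S : language) := term S nat.

Definition equation (S : language) (X : Type) : Type := (term S X * term S X)%type.

Record algebra (S : language) := Algebra {
  carrier :> Type;
  carrier_inhabited : inhabited carrier;
  op : forall f : symbol S, ('I_(arity f) -> carrier) -> carrier
}.

Arguments op {S} A f args : rename.

(* [eval v] is the unique homomorphism from the term algebra over [X] to [A]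
   extending [v]; homomorphisms from the formula algebra are therefore
   quantified over through valuations [v : nat -> A]. *)
Fixpoint eval (S : language) (A : algebra S) (X : Type) (v : X -> A)
    (t : term S X) : A :=
  match t with
  | Var x => v x
  | App f ts => op A f (fun i => eval v (ts i))
  end.

Fixpoint subst (S : language) (X Y : Type) (s : X -> term S Y)
    (t : term S X) : term S Y :=
  match t with
  | Var x => s x
  | App f ts => App f (fun i => subst s (ts i))
  end.

Definition satisfies (S : language) (A : algebra S) (X : Type) (v : X -> A)
    (e : equation S X) : Prop :=
  eval v e.1 = eval v e.2.

Definition eq_consequence (S : language) (K : algebra S -> Prop)
    (Theta : set (equation S nat)) (e : equation S nat) : Prop :=
  forall (A : algebra S) (v : nat -> A), K A ->
    (forall e', Theta e' -> satisfies v e') -> satisfies v e.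

Definition variety (S : language) (K : algebra S -> Prop) : Prop :=
  exists E : set (equation S nat), forall A : algebra S,
    K A <-> forall e (v : nat -> A), E e -> satisfies v e.

(** * Logics *)

Definition entailment (S : language) := set (formula S) -> formula S -> Prop.

(* Monotonicity follows from the first two conditions. No finitarity. *)
Definition is_logic (S : language) (D : entailment S) : Prop :=
  [/\ forall (Gamma : set (formula S)) phi, Gamma phi -> D Gamma phi,
      forall (Gamma Delta : set (formula S)) phi,
        (forall delta, Delta delta -> D Gamma delta) ->
        D Delta phi -> D Gamma phi
    & forall (s : nat -> formula S) (Gamma : set (formula S)) phi,
        D Gamma phi -> D [set subst s gamma | gamma in Gamma] (subst s phi)].

Definition is_extension (S : language) (D D' : entailment S) : Prop :=
  is_logic D' /\ forall Gamma phi, D Gamma phi -> D' Gamma phi.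

Definition sublanguage (S : language) (L : pred (symbol S)) : language :=
  @Language {f : symbol S | L f} (fun f => arity (sval f)).

Fixpoint incl (S : language) (L : pred (symbol S)) (X : Type)
    (t : term (sublanguage L) X) : term S X :=
  match t with
  | Var x => Var x
  | App f ts => App (sval f) (fun i => incl (ts i))
  end.

Definition fragment (S : language) (L : pred (symbol S)) (D : entailment S) :
    entailment (sublanguage L) :=
  fun Gamma phi => D [set incl gamma | gamma in Gamma] (incl phi).

(* The formula has its variables among the [arity c] places of [c]. *)
Definition term_definable (S : language) (K : algebra S -> Prop)
    (L : pred (symbol S)) (c : symbol S) : Prop :=
  exists t : term (sublanguage L) 'I_(arity c),
    forall A : algebra S, K A ->
    forall v : 'I_(arity c) -> A, eval v (incl t) = op A c v.

Definition instance (S : language) (e : equation S unit) (phi : formula S) :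
    equation S nat :=
  (subst (fun=> phi) e.1, subst (fun=> phi) e.2).

Definition has_algebraic_semantics (S : language) (D : entailment S) : Prop :=
  exists (tau : set (equation S unit)) (C : algebra S -> Prop),
    forall (Gamma : set (formula S)) (phi : formula S),
      D Gamma phi <->
      forall e, tau e ->
        eq_consequence C [set instance e' gamma | e' in tau & gamma in Gamma]
          (instance e phi).

(** * Modal logics *)

(* The defined connective [->] is kept as a symbol of the language, so that
   sublanguages may contain it without containing [\/] and [~]; in modal
   algebras it is forced to be [~ a \/ c]. *)
Inductive modal_symbol :=
  M_and | M_or | M_imp | M_neg | M_box | M_zero | M_one.

Definition modal_arity (f : modal_symbol) : nat :=
  match f with
  | M_and | M_or | M_imp => 2
  | M_neg | M_box => 1
  | M_zero | M_one => 0
  end.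

Definition modal_language := Language modal_arity.

Section ModalOperations.
Variable A : algebra modal_language.
Definition mand (a b : A) : A := op A M_and (tnth [tuple a; b]).
Definition mor (a b : A) : A := op A M_or (tnth [tuple a; b]).
Definition mimp (a b : A) : A := op A M_imp (tnth [tuple a; b]).
Definition mneg (a : A) : A := op A M_neg (tnth [tuple a]).
Definition mbox (a : A) : A := op A M_box (tnth [tuple a]).
Definition mzero : A := op A M_zero (tnth [tuple]).
Definition mone : A := op A M_one (tnth [tuple]).
Definition mle (a b : A) : Prop := mand a b = a.
End ModalOperations.

Arguments mzero {A}.
Arguments mone {A}.

Record lattice_axioms (T : Type) (meet join : T -> T -> T) : Prop := {
  meetC_ax : commutative meet;
  joinC_ax : commutative join;
  meetA_ax : associative meet;
  joinA_ax : associative join;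
  meetKU_ax : forall a b, meet a (join a b) = a;
  joinKI_ax : forall a b, join a (meet a b) = a
}.

Record modal_algebra (A : algebra modal_language) : Prop := {
  modal_lattice : lattice_axioms (@mand A) (@mor A);
  modal_distr : forall a b c : A, mand a (mor b c) = mor (mand a b) (mand a c);
  modal_zero : forall a : A, mor a mzero = a;
  modal_one : forall a : A, mand a mone = a;
  modal_negI : forall a : A, mand a (mneg a) = mzero;
  modal_negU : forall a : A, mor a (mneg a) = mone;
  modal_imp : forall a c : A, mimp a c = mor (mneg a) c;
  modal_box1 : mbox (@mone A) = mone;
  modal_boxI : forall a c : A, mbox (mand a c) = mand (mbox a) (mbox c)
}.

Definition M_one_fm : formula modal_language :=
  App (M_one : symbol modal_language) (tnth [tuple]).

Definition global_modal_logic (K : algebra modal_language -> Prop) :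
    entailment modal_language :=
  fun Gamma phi =>
    eq_consequence K [set (gamma, M_one_fm) | gamma in Gamma] (phi, M_one_fm).

Definition local_modal_logic (K : algebra modal_language -> Prop) :
    entailment modal_language :=
  fun Gamma phi =>
    forall (A : algebra modal_language) (a : A) (v : nat -> A), K A ->
      (forall gamma, Gamma gamma -> mle a (eval v gamma)) ->
      mle a (eval v phi).

(** * Substructural logics with exchange *)

Inductive fl_symbol := F_and | F_or | F_mul | F_imp | F_one | F_zero.

Definition fl_arity (f : fl_symbol) : nat :=
  match f with
  | F_and | F_or | F_mul | F_imp => 2
  | F_one | F_zero => 0
  end.

Definition fl_language := Language fl_arity.

Section FLOperations.
Variable A : algebra fl_language.
Definition fland (a b : A) : A := op A F_and (tnth [tuple a; b]).
Definition flor (a b : A) : A := op A F_or (tnth [tuple a; b]).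
Definition flmul (a b : A) : A := op A F_mul (tnth [tuple a; b]).
Definition flimp (a b : A) : A := op A F_imp (tnth [tuple a; b]).
Definition flone : A := op A F_one (tnth [tuple]).
Definition flle (a b : A) : Prop := fland a b = a.
End FLOperations.

Arguments flone {A}.

(* The constant [F_zero] is subject to no condition. *)
Record commutative_FL_algebra (A : algebra fl_language) : Prop := {
  fl_lattice : lattice_axioms (@fland A) (@flor A);
  fl_mulC : commutative (@flmul A);
  fl_mulA : associative (@flmul A);
  fl_mul1 : forall a : A, flmul flone a = a;
  fl_residuation : forall a b c : A, flle (flmul a b) c <-> flle a (flimp b c)
}.

Definition F_one_fm : formula fl_language :=
  App (F_one : symbol fl_language) (tnth [tuple]).

Definition meet_one (phi : formula fl_language) : formula fl_language :=
  App (F_and : symbol fl_language) (tnth [tuple phi; F_one_fm]).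

Definition substructural_logic (K : algebra fl_language -> Prop) :
    entailment fl_language :=
  fun Gamma phi =>
    eq_consequence K [set (meet_one gamma, F_one_fm) | gamma in Gamma]
      (meet_one phi, F_one_fm).

(* Main.v *)
Require Import Defs.
From mathcomp Require Import all_boot.
From mathcomp Require Import boolp classical_sets.

(** If [K] is not trivial, a term defining a binary connective must contain both
    variables; as the languages have no symbol of arity above 2, the fragment
    itself contains a primitive binary connective [f] among the listed ones.
    Put [beta x := f (f x x) x].  Then [K] validates [beta x = alpha x] with
    [alpha x := x] (meet, join, implication) or [alpha x := f x (f x x)]
    (product).  For a theory [T] of the extension, let the term algebra be
    modified so that [beta d] is contracted to [alpha d] exactly when [d] is in
    [T].  Since no instance of [beta] is an instance of a non-variable subterm
    of [alpha] or of a proper one of [beta], the solutions of [alpha x = beta x] in this algebra are the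
    elements of [T], and these algebras form an algebraic semantics. *)

Set Implicit Arguments.
Unset Strict Implicit.
Unset Printing Implicit Defensive.

Local Open Scope classical_set_scope.

(** * Evaluation and height of terms *)

Lemma eval_subst (S : language) (A : algebra S) (X Y : Type) (v : Y -> A)
    (s : X -> term S Y) (t : term S X) :
  eval v (subst s t) = eval (fun x => eval v (s x)) t.
Proof. by elim: t => //= f ts IH; congr (op A f); apply/funext. Qed.

Lemma subst_Var (S : language) (X : Type) (t : term S X) : subst Var t = t.
Proof. by elim: t => //= f ts IH; congr (App f); apply/funext. Qed.

Fixpoint height (S : language) (X : Type) (t : term S X) : nat :=
  match t with
  | Var _ => 0
  | App f ts => (\max_(i < arity f) height (ts i)).+1
  end.

(** A total projection, returning [t] itself when [n] is out of range: applied to both sides of an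
    equation it compares arguments without inverting a dependent equality. *)
Definition arg_nth (S : language) (X : Type) (n : nat) (t : term S X) :
    term S X :=
  match t with
  | Var x => Var x
  | App f ts => if insub n is Some i then ts i else t
  end.

(** * Terms built from one binary connective *)

Section BinaryConnective.
Variables (S : language) (f : symbol S).

(* At arity above 2 the second argument is repeated. *)
Definition args2 (X : Type) (a b : X) : 'I_(arity f) -> X :=
  fun i => if val i == 0 then a else b.

Definition App2 (X : Type) (t u : term S X) : term S X := App f (args2 t u).

Definition op2 (A : algebra S) (a b : A) : A := op A f (args2 a b).

Lemma comp_args2 (X Y : Type) (h : X -> Y) (a b : X) :
  (fun i => h (args2 a b i)) = args2 (h a) (h b).
Proof. by apply/funext => i; rewrite /args2; case: ifP. Qed.

Lemma eval_App2 (A : algebra S) (X : Type) (v : X -> A) (t u : term S X) :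
  eval v (App2 t u) = op2 (eval v t) (eval v u).
Proof. by rewrite /App2 /= (comp_args2 (eval v)). Qed.

Lemma subst_App2 (X Y : Type) (s : X -> term S Y) (t u : term S X) :
  subst s (App2 t u) = App2 (subst s t) (subst s u).
Proof. by rewrite /App2 /= (comp_args2 (subst s)). Qed.

Hypothesis arity_f : 1 < arity f.

Lemma App2_inj (X : Type) (t u t' u' : term S X) :
  App2 t u = App2 t' u' -> t = t' /\ u = u'.
Proof.
move=> e; split.
  by have := congr1 (arg_nth 0) e; rewrite /= !insubT ?(ltnW arity_f).
by have := congr1 (arg_nth 1) e; rewrite /= !insubT.
Qed.

Lemma height_App2l (X : Type) (t u : term S X) : height t < height (App2 t u).
Proof.
exact: (@leq_bigmax _ (fun i => height (args2 t u i)) (Ordinal (ltnW arity_f))).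
Qed.

Lemma height_App2r (X : Type) (t u : term S X) : height u < height (App2 t u).
Proof.
exact: (@leq_bigmax _ (fun i => height (args2 t u i)) (Ordinal arity_f)).
Qed.

Lemma App2_neql (X : Type) (t u : term S X) : App2 t u <> t.
Proof. by move=> e; have := height_App2l t u; rewrite e ltnn. Qed.

Lemma App2_neqr (X : Type) (t u : term S X) : App2 t u <> u.
Proof. by move=> e; have := height_App2r t u; rewrite e ltnn. Qed.

Definition beta (X : Type) (x : term S X) : term S X := App2 (App2 x x) x.

(** Uniform in the type of variables, since [alpha] serves both as a term in one variable and as an
    operation on formulas. *)
Definition is_alpha (alpha : forall X, term S X -> term S X) : Prop :=
  alpha = (fun X x => x) \/ alpha = (fun X x => App2 x (App2 x x)).

(** * The contraction algebra of a set of formulas *)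

Section Contraction.
Variable alpha : forall X, term S X -> term S X.
Hypothesis alphaP : is_alpha alpha.
Variable T : set (formula S).

Lemma beta_inj (X : Type) : injective (@beta X).
Proof. by move=> t u /App2_inj[]. Qed.

Lemma beta_neq_App2_diag (X : Type) (t u : term S X) : App2 t t <> beta u.
Proof. by move=> /App2_inj[-> e]; exact: App2_neql e. Qed.

Lemma beta_neq_comb (X : Type) (t u : term S X) : App2 t (App2 t t) <> beta u.
Proof.
move=> /App2_inj[et eu].
(* The component equations give [t = App2 u u] with [u = App2 t t], which would place [t] strictly
   inside itself. *)
have := ltn_trans (height_App2l t t) (height_App2l (App2 t t) (App2 t t)).
by rewrite {1}et eu ltnn.
Qed.

(** Makes the defining equation fail wherever [beta t] is left uncontracted. *)
Lemma alpha_neq_beta (X : Type) (t : term S X) : alpha t <> beta t.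
Proof.
case: alphaP => ->; last exact: beta_neq_comb.
by move=> /esym; exact: App2_neqr.
Qed.

(** Acts at the root only; as [beta] is injective, the choice of [d] is immaterial. *)
Definition contract (t : formula S) : formula S :=
  match pselect (exists2 d, T d & t = beta d) with
  | left p => alpha (sval (cid2 p))
  | right _ => t
  end.

Lemma contract_beta (d : formula S) : T d -> contract (beta d) = alpha d.
Proof.
move=> Td; rewrite /contract; case: pselect => [p|[]]; last by exists d.
by case: cid2 => e /= _ /beta_inj <-.
Qed.

Lemma contract_id (t : formula S) :
  (forall d, T d -> t <> beta d) -> contract t = t.
Proof.
move=> tN; rewrite /contract; case: pselect => // p.
by have [d Td /(tN _ Td)] := p.
Qed.

Definition contraction_algebra : algebra S :=
  @Algebra S (formula S) (inhabits (Var 0)) (fun g ts => contract (App g ts)).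

(** The inner terms, and [alpha d] itself, are built without contraction; only the root of [beta d]
    can be contracted, which happens exactly when [d] is in [T]. *)
Lemma eval_alpha_beta (v : unit -> contraction_algebra) :
  eval v (alpha (Var tt)) = eval v (beta (Var tt)) <-> T (v tt).
Proof.
set d := v tt.
have op2E a b : @op2 contraction_algebra a b = contract (App2 a b) by [].
have dd : @op2 contraction_algebra d d = App2 d d.
  by rewrite op2E contract_id // => e _; exact: beta_neq_App2_diag.
have -> : eval v (alpha (Var tt)) = alpha d.
  case: alphaP => -> //; rewrite !eval_App2 -[eval v (Var tt)]/d dd op2E.
  rewrite contract_id // => e _; exact: beta_neq_comb.
rewrite /beta !eval_App2 -[eval v (Var tt)]/d dd op2E -/(beta d).
split=> [e|Td]; last by rewrite contract_beta.
(* For [d] outside [T], injectivity leaves [beta d] intact, so the equation would identify [alpha d]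
   with [beta d]. *)
apply: contrapT => nTd; apply: (@alpha_neq_beta _ d).
by rewrite e contract_id // => u Tu /beta_inj du; apply: nTd; rewrite du.
Qed.

End Contraction.

(** * Contraction algebras of theories as an algebraic semantics *)

Section Semantics.
Variables (D : entailment S) (M : algebra S -> Prop).
Hypothesis D_logic : is_logic D.
Hypothesis D_M : forall phi psi : formula S,
  (forall (A : algebra S) (v : nat -> A), M A -> eval v phi = eval v psi) ->
  D [set phi] psi.
Variable alpha : forall X, term S X -> term S X.
Hypothesis alphaP : is_alpha alpha.
Hypothesis M_alpha_beta : forall (A : algebra S) (v : unit -> A), M A ->
  eval v (alpha (Var tt)) = eval v (beta (Var tt)).

Definition theory (T : set (formula S)) : Prop := forall phi, D T phi -> T phi.

Lemma theory_deduction (Gamma : set (formula S)) : theory (D Gamma).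
Proof. by case: D_logic => _ cut _ phi; exact: cut. Qed.

(** Needed because values in a contraction algebra agree with substituted formulas only up to
    equality in [M]. *)
Lemma theory_M_equal (T : set (formula S)) (phi psi : formula S) :
  theory T ->
  (forall (A : algebra S) (v : nat -> A), M A -> eval v phi = eval v psi) ->
  T phi -> T psi.
Proof.
case: D_logic => ax cut _ Tth e Tphi; apply: Tth; apply: cut (D_M e).
by move=> _ ->; exact: ax.
Qed.

Lemma subst_alpha (X Y : Type) (s : X -> term S Y) (t : term S X) :
  subst s (alpha t) = alpha (subst s t).
Proof. by case: alphaP => ->; rewrite ?subst_App2. Qed.

Lemma subst_beta (X Y : Type) (s : X -> term S Y) (t : term S X) :
  subst s (beta t) = beta (subst s t).
Proof. by rewrite /beta !subst_App2. Qed.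

Lemma M_contract (T : set (formula S)) (t : formula S) (A : algebra S)
    (v : nat -> A) : M A -> eval v (contract alpha T t) = eval v t.
Proof.
move=> MA; rewrite /contract; case: pselect => // p.
(* Viewing [d] as a substitution instance of the single variable makes the one-variable identity of
   [M] applicable. *)
case: cid2 => d /= _ ->; rewrite -[d in LHS]/(subst (fun=> d) (Var tt)).
rewrite -[d in RHS]/(subst (fun=> d) (Var tt)) -subst_alpha -subst_beta.
by rewrite !eval_subst M_alpha_beta.
Qed.

(** The two formulas differ by contractions only, and [M] does not see these. *)
Lemma eval_contraction (T : set (formula S)) (w : nat -> formula S)
    (t : formula S) (A : algebra S) (v : nat -> A) : M A ->
  eval v (@eval S (contraction_algebra alpha T) nat w t) = eval v (subst w t).
Proof.
move=> MA; elim: t => //= g ts IH; rewrite M_contract //=.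
by congr (op A g); apply/funext.
Qed.

Lemma algebraic_semantics_of_contractions : has_algebraic_semantics D.
Proof.
exists [set (alpha (Var tt), beta (Var tt))].
exists (fun B => exists2 T, theory T & B = contraction_algebra alpha T).
pose tau0 := (alpha (Var tt), beta (Var tt)) : equation S unit.
have satE T (w : nat -> contraction_algebra alpha T) phi : theory T ->
    satisfies w (instance tau0 phi) <-> T (subst w phi).
  move=> Tth; rewrite /satisfies !eval_subst.
  (* The equation says that the value of [phi] is in [T]; this value is equal in [M] to
     [subst w phi]. *)
  apply: iff_trans (eval_alpha_beta alphaP _) _.
  by split; apply: theory_M_equal => // A v MA; rewrite eval_contraction.
case: (D_logic) => ax cut substD Gamma phi; split=> [Dphi _ -> B w [T Tth BE]|].
  (* Soundness: a valuation [w] is a substitution, so substitution invariance applies. *)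
  subst B => sat; apply/(satE T w) => //; apply: (Tth).
  apply: cut (substD w _ _ Dphi) => _ [gamma Ggamma <-]; apply: ax.
  by apply/satE => //; apply: sat; exists tau0 => //; exists gamma.
(* Completeness: the countermodel is the contraction algebra of the theory [D Gamma], under the
   identity substitution. *)
move=> /(_ _ erefl) sem; have DGth := @theory_deduction Gamma.
rewrite -[phi]subst_Var; apply/(satE (D Gamma) Var) => //.
apply: sem; first by exists (D Gamma).
move=> _ [_ -> [gamma Ggamma <-]]; apply/satE => //.
by rewrite subst_Var; exact: ax.
Qed.

End Semantics.
End BinaryConnective.

(** * Fragments and reducts *)

Section Fragments.
Variables (S : language) (L : pred (symbol S)).

Definition reduct (A : algebra S) : algebra (sublanguage L) :=
  @Algebra (sublanguage L) A (carrier_inhabited A) (fun f => op A (sval f)).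

Lemma eval_incl (A : algebra S) (X : Type) (v : X -> A)
    (t : term (sublanguage L) X) :
  eval v (incl t) = @eval (sublanguage L) (reduct A) X v t.
Proof. by elim: t => //= f ts IH; congr (op A (sval f)); apply/funext. Qed.

(** Such a term is a chain of unary symbols ending in a variable or a constant; in the latter case
    [x0] serves as an arbitrary witness. *)
Lemma incl_single_variable (X : Type) (x0 : X) (t : term (sublanguage L) X) :
  (forall f, L f -> arity f <= 1) ->
  exists x, forall (A : algebra S) (v w : X -> A),
    v x = w x -> eval v (incl t) = eval w (incl t).
Proof.
move=> ar; elim: t => [x|[f Lf] ts IH]; first by exists x.
case: (posnP (arity f)) => [f0|f_gt0].
  exists x0 => A v w _ /=; congr (op A f); apply/funext => i.
  by have := ltn_ord i; rewrite [X in _ < X]f0.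
have [x xP] := IH (Ordinal f_gt0); exists x => A v w vw /=.
congr (op A f); apply/funext => i.
suff -> : i = Ordinal f_gt0 by exact: xP.
apply/val_inj/eqP; rewrite -leqn0 -ltnS.
exact: leq_trans (ltn_ord i) (ar f Lf).
Qed.

End Fragments.

(** With no equations in [tau], every consequence holds vacuously. *)
Lemma algebraic_semantics_total (S : language) (D : entailment S) :
  (forall Gamma phi, D Gamma phi) -> has_algebraic_semantics D.
Proof. by move=> Dtot; exists set0, (fun=> True) => Gamma phi; split. Qed.

(** The contraction argument applies with [M] the class of [L]-reducts of members of [K]; the two
    identities allowed for [f] match the two choices of [alpha]. *)
Lemma algebraic_semantics_of_fragment_extension (S : language)
    (K : algebra S -> Prop) (L : pred (symbol S)) (D0 : entailment S)
    (D : entailment (sublanguage L)) (f : symbol S) :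
  L f -> 1 < arity f ->
  (forall phi psi : formula S,
     (forall (A : algebra S) (v : nat -> A), K A -> eval v phi = eval v psi) ->
     D0 [set phi] psi) ->
  (forall (A : algebra S) (a : A), K A -> op2 f (op2 f a a) a = a) \/
  (forall (A : algebra S) (a : A), K A ->
     op2 f (op2 f a a) a = op2 f a (op2 f a a)) ->
  is_extension (fragment (L := L) D0) D -> has_algebraic_semantics D.
Proof.
move=> Lf ar D0K f_eq [D_logic D0D].
pose g : symbol (sublanguage L) := exist _ f Lf.
pose M B := exists2 A, K A & B = reduct L A.
have DM phi psi : (forall (A : algebra (sublanguage L)) (v : nat -> A),
    M A -> eval v phi = eval v psi) -> D [set phi] psi.
  move=> e; apply: D0D; rewrite /fragment image_set1; apply: D0K => A v KA.
  by rewrite !eval_incl; apply: (e (reduct L A) v); exists A.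
case: f_eq => f_eq.
- apply: (@algebraic_semantics_of_contractions _ g ar D M D_logic DM
    (fun X x => x)); first by left.
  move=> B v [A KA BE]; subst B; rewrite /beta !eval_App2.
  exact/esym/(f_eq A (v tt) KA).
- apply: (@algebraic_semantics_of_contractions _ g ar D M D_logic DM
    (fun X x => App2 g x (App2 g x x))); first by right.
  move=> B v [A KA BE]; subst B; rewrite /beta !eval_App2.
  exact/esym/(f_eq A (v tt) KA).
Qed.

(** * Operations that ignore an argument *)

Definition ignores_argument (T : Type) (h : T -> T -> T) : Prop :=
  (forall a b b', h a b = h a b') \/ (forall a a' b, h a b = h a' b).

(** The defining term depends on one place [i] only: if [i] is 0 the second argument is ignored,
    otherwise the first. *)
Lemma definable_ignores_argument (S : language) (K : algebra S -> Prop)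
    (L : pred (symbol S)) (c : symbol S) (A : algebra S) :
  1 < arity c -> (forall f, L f -> arity f <= 1) ->
  term_definable K L c -> K A -> ignores_argument (@op2 S c A).
Proof.
move=> ar_c ar [t tP] KA.
have [i iP] := incl_single_variable (Ordinal (ltnW ar_c)) t ar.
have opP v w : v i = w i -> op A c v = op A c w.
  by move=> vw; rewrite -!(tP A KA); exact: iP.
by case: (eqVneq (val i) 0) => i0; [left|right] => a b d; apply: opP;
  rewrite /args2 ?i0 ?(negPf i0).
Qed.

(** Links [args2] at arity 2 to the tuples used in the modal and FL operations. *)
Lemma args2_tnth (T : Type) (a b : T) :
  (fun i : 'I_2 => if val i == 0 then a else b) = tnth [tuple a; b].
Proof. by apply/funext => -[[|[|//]] lti]; rewrite (tnth_nth a). Qed.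

Section Lattices.
Variables (T : Type) (meet join : T -> T -> T).
Hypothesis lat : lattice_axioms meet join.

Lemma meet_idem (a : T) : meet a a = a.
Proof. by rewrite -[X in meet _ X](joinKI_ax lat a a) (meetKU_ax lat). Qed.

Lemma join_idem (a : T) : join a a = a.
Proof. by rewrite -[X in join _ X](meetKU_ax lat a a) (joinKI_ax lat). Qed.

End Lattices.

(** Commutativity carries the ignored argument to the other side. For an idempotent or unital
    operation, constancy then leaves a single element. *)
Lemma ignores_argument_comm_const (T : Type) (h : T -> T -> T) (a b a' b' : T) :
  commutative h -> ignores_argument h -> h a b = h a' b'.
Proof.
move=> hC [hI|hI]; first by rewrite (hI a b a') hC (hI a' a b').
by rewrite (hI a b' b) hC (hI b a' b') hC.
Qed.

(** * Identities and triviality in modal algebras *)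

Section ModalAlgebras.
Variable A : algebra modal_language.
Hypothesis A_modal : modal_algebra A.
Implicit Types a b : A.

Lemma op2_mand a b : op2 (M_and : symbol modal_language) a b = mand a b.
Proof. by rewrite /op2 /mand -args2_tnth. Qed.

Lemma op2_mor a b : op2 (M_or : symbol modal_language) a b = mor a b.
Proof. by rewrite /op2 /mor -args2_tnth. Qed.

Lemma op2_mimp a b : op2 (M_imp : symbol modal_language) a b = mimp a b.
Proof. by rewrite /op2 /mimp -args2_tnth. Qed.

Lemma mimp_refl a : mimp a a = mone.
Proof.
rewrite (modal_imp A_modal) (joinC_ax (modal_lattice A_modal)).
exact: modal_negU.
Qed.

Lemma mimp1 a : mimp mone a = a.
Proof.
have lat := modal_lattice A_modal.
have n1 : mneg mone = @mzero A.
  by rewrite -(modal_negI A_modal mone) (meetC_ax lat) (modal_one A_modal).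
by rewrite (modal_imp A_modal) n1 (joinC_ax lat) (modal_zero A_modal).
Qed.

Lemma modal_ignores_argument_trivial (c : modal_symbol) a b :
  c = M_and \/ c = M_or \/ c = M_imp ->
  ignores_argument (@op2 modal_language c A) -> a = b.
Proof.
have lat := modal_lattice A_modal.
move=> [->|[->|->]] cI.
- rewrite -(meet_idem lat a) -(meet_idem lat b) -!op2_mand.
  apply: ignores_argument_comm_const cI => x y.
  by rewrite !op2_mand (meetC_ax lat).
- rewrite -(join_idem lat a) -(join_idem lat b) -!op2_mor.
  apply: ignores_argument_comm_const cI => x y.
  by rewrite !op2_mor (joinC_ax lat).
(* Implication is not commutative; instead [x] is [mimp mone x], and changing the ignored argument
   turns this into [mimp mone mone] or [mimp x x]. *)
- suff one (x : A) : x = mone by rewrite (one a) (one b).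
  rewrite -[LHS]mimp1; case: cI => cI; rewrite -op2_mimp.
    by rewrite (cI _ _ mone) op2_mimp mimp_refl.
  by rewrite (cI _ x) op2_mimp mimp_refl.
Qed.

Lemma modal_beta (c : modal_symbol) a :
  c = M_and \/ c = M_or \/ c = M_imp ->
  op2 (c : symbol modal_language) (op2 (c : symbol modal_language) a a) a = a.
Proof.
have lat := modal_lattice A_modal.
move=> [->|[->|->]].
- by rewrite !op2_mand !(meet_idem lat).
- by rewrite !op2_mor !(join_idem lat).
- by rewrite !op2_mimp mimp_refl mimp1.
Qed.

End ModalAlgebras.

(** * Identities and triviality in commutative FL-algebras *)

Section FLAlgebras.
Variable A : algebra fl_language.
Hypothesis A_FL : commutative_FL_algebra A.
Implicit Types a b c : A.

Let lat := fl_lattice A_FL.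

Lemma op2_fland a b : op2 (F_and : symbol fl_language) a b = fland a b.
Proof. by rewrite /op2 /fland -args2_tnth. Qed.

Lemma op2_flor a b : op2 (F_or : symbol fl_language) a b = flor a b.
Proof. by rewrite /op2 /flor -args2_tnth. Qed.

Lemma op2_flmul a b : op2 (F_mul : symbol fl_language) a b = flmul a b.
Proof. by rewrite /op2 /flmul -args2_tnth. Qed.

Lemma op2_flimp a b : op2 (F_imp : symbol fl_language) a b = flimp a b.
Proof. by rewrite /op2 /flimp -args2_tnth. Qed.

Lemma flle_refl a : flle a a.
Proof. exact: meet_idem lat a. Qed.

Lemma flle_anti a b : flle a b -> flle b a -> a = b.
Proof. by rewrite /flle => ab ba; rewrite -[LHS]ab (meetC_ax lat). Qed.

Lemma flle_trans a b c : flle a b -> flle b c -> flle a c.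
Proof. by rewrite /flle => ab bc; rewrite -ab -(meetA_ax lat) bc. Qed.

Lemma flmulr1 a : flmul a flone = a.
Proof. by rewrite (fl_mulC A_FL) (fl_mul1 A_FL). Qed.

Lemma flimpP a b c : flle (flmul a b) c <-> flle a (flimp b c).
Proof. exact: fl_residuation. Qed.

Lemma flimp1 a : flimp flone a = a.
Proof.
apply: flle_anti.
  by rewrite -[flimp _ _]flmulr1; apply/flimpP/flle_refl.
by apply/flimpP; rewrite flmulr1; exact: flle_refl.
Qed.

Lemma flimp_refl_ge1 a : flle flone (flimp a a).
Proof. by apply/flimpP; rewrite (fl_mul1 A_FL); exact: flle_refl. Qed.

Lemma flmul_flimp a b : flle (flmul a (flimp a b)) b.
Proof. by rewrite (fl_mulC A_FL); apply/flimpP/flle_refl. Qed.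

Lemma flimp_refl_l a : flimp (flimp a a) a = a.
Proof.
apply: flle_anti; last by apply/flimpP/flmul_flimp.
rewrite -[X in flle X _](fl_mul1 A_FL); apply/flimpP.
apply: flle_trans (flimp_refl_ge1 a) _; apply/flimpP; exact: flmul_flimp.
Qed.

Lemma FL_ignores_argument_trivial (c : fl_symbol) a b :
  c = F_and \/ c = F_or \/ c = F_mul \/ c = F_imp ->
  ignores_argument (@op2 fl_language c A) -> a = b.
Proof.
move=> [->|[->|[->|->]]] cI.
- rewrite -(meet_idem lat a) -(meet_idem lat b) -!op2_fland.
  apply: ignores_argument_comm_const cI => x y.
  by rewrite !op2_fland (meetC_ax lat).
- rewrite -(join_idem lat a) -(join_idem lat b) -!op2_flor.
  apply: ignores_argument_comm_const cI => x y.
  by rewrite !op2_flor (joinC_ax lat).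
- rewrite -(fl_mul1 A_FL a) -(fl_mul1 A_FL b) -!op2_flmul.
  apply: ignores_argument_comm_const cI => x y.
  by rewrite !op2_flmul (fl_mulC A_FL).
- case: cI => cI.
    by rewrite -(flimp1 a) -(flimp1 b) -!op2_flimp.
  (* If the antecedent is ignored, implication returns its second argument; so every element is
     above [flone], and by residuation any two elements are comparable both ways. *)
  have impE (x y : A) : flimp x y = y by rewrite -[RHS]flimp1 -!op2_flimp.
  have ge1 (x : A) : flle flone x by have := flimp_refl_ge1 x; rewrite impE.
  have le (x y : A) : flle x y.
    by rewrite -(fl_mul1 A_FL x); apply/flimpP; rewrite impE.
  exact: flle_anti.
Qed.

Lemma FL_beta (c : fl_symbol) a :
  c = F_and \/ c = F_or \/ c = F_imp ->
  op2 (c : symbol fl_language) (op2 (c : symbol fl_language) a a) a = a.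
Proof.
move=> [->|[->|->]].
- by rewrite !op2_fland !(meet_idem lat).
- by rewrite !op2_flor !(join_idem lat).
- by rewrite !op2_flimp flimp_refl_l.
Qed.

End FLAlgebras.

(** * Formulas with equal values entail each other *)

Lemma local_modal_logic_equal (K : algebra modal_language -> Prop)
    (phi psi : formula modal_language) :
  (forall (A : algebra modal_language) (v : nat -> A), K A ->
     eval v phi = eval v psi) ->
  local_modal_logic K [set phi] psi.
Proof. by move=> e A a v KA /(_ phi erefl); rewrite e. Qed.

Lemma global_modal_logic_equal (K : algebra modal_language -> Prop)
    (phi psi : formula modal_language) :
  (forall (A : algebra modal_language) (v : nat -> A), K A ->
     eval v phi = eval v psi) ->
  global_modal_logic K [set phi] psi.
Proof.
move=> e A v KA /(_ (phi, M_one_fm)); rewrite /satisfies /= e //.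
by apply; exists phi.
Qed.

Lemma substructural_logic_equal (K : algebra fl_language -> Prop)
    (phi psi : formula fl_language) :
  (forall (A : algebra fl_language) (v : nat -> A), K A ->
     eval v phi = eval v psi) ->
  substructural_logic K [set phi] psi.
Proof.
have meetE (A : algebra fl_language) (v : nat -> A) chi :
    eval v (meet_one chi) = fland (eval v chi) (eval v F_one_fm).
  rewrite /= /fland; congr (op A F_and); rewrite -!args2_tnth.
  by apply/funext => i /=; case: ifP.
move=> e A v KA /(_ (meet_one phi, F_one_fm)); rewrite /satisfies /= -/(eval v).
rewrite -[op A F_and _]/(eval v (meet_one phi)).
rewrite -[X in _ -> X = _]/(eval v (meet_one psi)) !meetE e //.
by apply; exists phi.
Qed.

(** * Case split on a listed connective being primitive in the fragment *)

Theorem theorem7p3 :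
  (forall (K : algebra modal_language -> Prop)
          (L : pred (symbol modal_language))
          (D : entailment (sublanguage L)),
     variety K ->
     (forall A, K A -> modal_algebra A) ->
     (exists c : modal_symbol,
        (c = M_and \/ c = M_or \/ c = M_imp) /\
        @term_definable modal_language K L c) ->
     (is_extension (fragment (L := L) (local_modal_logic K)) D \/
      is_extension (fragment (L := L) (global_modal_logic K)) D) ->
     has_algebraic_semantics D)
  /\
  (forall (K : algebra fl_language -> Prop)
          (L : pred (symbol fl_language))
          (D : entailment (sublanguage L)),
     variety K ->
     (forall A, K A -> commutative_FL_algebra A) ->
     (exists c : fl_symbol,
        (c = F_and \/ c = F_or \/ c = F_mul \/ c = F_imp) /\
        @term_definable fl_language K L c) ->
     is_extension (fragment (L := L) (substructural_logic K)) D ->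
     has_algebraic_semantics D).
Proof.
split=> K L D _ KA [c [cP c_def]] ext.
- have [[f Lf fP]|noL] := pselect (exists2 f : modal_symbol, L f &
      f = M_and \/ f = M_or \/ f = M_imp).
    have ar : 1 < @arity modal_language f by case: fP => [->|[->|->]].
    have f_eq : forall (A : algebra modal_language) (a : A), K A ->
        @op2 modal_language f A (@op2 modal_language f A a a) a = a.
      by move=> A a /KA A_modal; exact: modal_beta.
    case: ext; apply: (algebraic_semantics_of_fragment_extension Lf ar) => //.
    + exact: local_modal_logic_equal.
    + by left.
    + exact: global_modal_logic_equal.
    + by left.
  (* Only negation, box and the constants can remain in [L], so a definable listed connective makes
     all members of [K] trivial and [D] total. *)
  have ar f : L f -> @arity modal_language f <= 1.
    by case: f => // Lf; case: noL;
      [exists M_and|exists M_or|exists M_imp] => //; tauto.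
  have trivK (A : algebra modal_language) (a b : A) : K A -> a = b.
    move=> KAA; apply: (modal_ignores_argument_trivial (KA A KAA) a b cP).
    apply: definable_ignores_argument c_def KAA => //.
    by case: cP => [->|[->|->]].
  apply: algebraic_semantics_total => Gamma phi.
  case: ext => -[_ D0D]; apply: D0D; first by move=> A a v KAA _; exact: trivK.
  by move=> A v KAA _; exact: trivK.
- have [[f Lf fP]|noL] := pselect (exists2 f : fl_symbol, L f &
      f = F_and \/ f = F_or \/ f = F_mul \/ f = F_imp).
    have ar : 1 < @arity fl_language f by case: fP => [->|[->|[->|->]]].
    apply: (algebraic_semantics_of_fragment_extension Lf ar _ _ ext).
      exact: substructural_logic_equal.
    (* Product need not satisfy the identity with right side [a], but associativity gives the other
       one. *)
    have [fE|fN] := pselect (f = F_mul); [right|left] => A a /KA A_FL.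
      by rewrite fE !op2_flmul (fl_mulA A_FL).
    by apply: FL_beta => //; tauto.
  (* Only the constants can remain in [L], and again [K] is trivial and [D] total. *)
  have ar f : L f -> @arity fl_language f <= 1.
    by case: f => // Lf; case: noL;
      [exists F_and|exists F_or|exists F_mul|exists F_imp] => //; tauto.
  have trivK (A : algebra fl_language) (a b : A) : K A -> a = b.
    move=> KAA; apply: (FL_ignores_argument_trivial (KA A KAA) a b cP).
    apply: definable_ignores_argument c_def KAA => //.
    by case: cP => [->|[->|[->|->]]].
  apply: algebraic_semantics_total => Gamma phi.
  by case: ext => _; apply => A v KAA _; exact: trivK.
Qed.
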